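(* Let $M$ be a closed connected surface with a triangulation $\mathcal{T}=\{V,E,F\}$, $V=\{1,\dots,N\}$, let $I:E\to[0,+\infty)$ be an inversive distance, and let $\alpha\in\mathbb{R}$ satisfy $\alpha\chi(M)\le 0$. Then the constant $\alpha$-curvature metric is unique up to scaling if it exists: if $r,r'\in\Omega$ are both constant $\alpha$-curvature metrics, then $r'=\lambda r$ for some $\lambda>0$.
   Context: $V,E,F$ are the vertices, edges and faces of $\mathcal{T}$, $N=|V|$. For $r\in\mathbb{R}^N_{>0}$ each edge $\{ij\}\in E$ gets length $l_{ij}=\sqrt{r_i^2+r_j^2+2r_ir_jI_{ij}}$. $\Omega$ is the set of all $r\in\mathbb{R}^N_{>0}$ such that for every face $\{ijk\}\in F$ the lengths $l_{ij},l_{jk},l_{ik}$ satisfy the three strict triangle inequalities; elements of $\Omega$ are called (inversive distance circle packing) metrics. For $r\in\Omega$, $\theta_i^{jk}$ is the inner angle at vertex $i$ of the Euclidean triangle $\{ijk\}$ with these edge lengths, and $K_i=2\pi-\sum_{\{ijk\}\in F}\theta_i^{jk}$ (sum over the triangles having $i$ as a vertex). The $\alpha$-curvature at $i$ is $R_{\alpha,i}=K_i/r_i^\alpha$; $r\in\Omega$ is a constant $\alpha$-curvature metric if $R_{\alpha,i}$ is the same for all $i\in V$. *)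

(* Defs.v *)
From mathcomp Require Import all_boot all_order all_algebra.
From mathcomp Require Import reals exp trigo.
Set Implicit Arguments.
Unset Strict Implicit.
Unset Printing Implicit Defensive.
Import Order.TTheory GRing.Theory Num.Theory.
Local Open Scope ring_scope.

(* A triangulation, with vertex set 'I_N, of a closed connected surface,
   orientable or not: a nonempty connected simplicial complex of dimension 2,
   given by its edges and its triangles, in which the link of every vertex is a
   circle.  The link of i is the graph on the neighbours of i where j and k are
   adjacent when {i, j, k} is a face.  [two_faces] makes it 2-regular, so it is
   a single cycle once it is nonempty and connected. *)
Record surface_triangulation (N : nat) := SurfaceTriangulation {
  edges : {set {set 'I_N}};
  faces : {set {set 'I_N}};
  vertices_nonempty : (0 < N)%N;
  card_edge : forall e, e \in edges -> #|e| = 2%N;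
  card_face : forall f, f \in faces -> #|f| = 3%N;
  edge_of_face : forall e f : {set 'I_N},
    f \in faces -> e \subset f -> #|e| = 2%N -> e \in edges;
  two_faces : forall e, e \in edges -> #|[set f in faces | e \subset f]| = 2%N;
  link_nonempty : forall i, exists2 f, f \in faces & i \in f;
  link_connected : forall i j k, [set i; j] \in edges -> [set i; k] \in edges ->
    connect (fun a b => [set i; a; b] \in faces) j k;
  skeleton_connected : forall i j, connect (fun a b => [set a; b] \in edges) i j
}.

Definition euler_char (N : nat) (T : surface_triangulation N) : int :=
  N%:Z - #|edges T|%:Z + #|faces T|%:Z.

Section CirclePacking.
Variables (R : realType) (N : nat) (T : surface_triangulation N).

(* Only the values on [edges T] are meaningful. *)
Variable I : {set 'I_N} -> R.

Implicit Types (r : 'rV[R]_N) (i j k : 'I_N).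

Definition inversive_distance : Prop := forall e, e \in edges T -> 0 <= I e.

Definition edge_length r i j : R :=
  Num.sqrt (r 0 i ^+ 2 + r 0 j ^+ 2 + 2 * r 0 i * r 0 j * I [set i; j]).

(* The set Omega. *)
Definition is_metric r : Prop :=
  (forall i, 0 < r 0 i) /\
  forall i j k, [set i; j; k] \in faces T ->
    [/\ edge_length r i j < edge_length r j k + edge_length r i k,
        edge_length r j k < edge_length r i j + edge_length r i k &
        edge_length r i k < edge_length r i j + edge_length r j k].

(* Inner angle of a Euclidean triangle with side lengths a, b, c, at the vertex
   common to the sides of lengths a and b (law of cosines). *)
Definition euclidean_angle (a b c : R) : R :=
  acos ((a ^+ 2 + b ^+ 2 - c ^+ 2) / (2 * a * b)).

Definition inner_angle r i j k : R :=
  euclidean_angle (edge_length r i j) (edge_length r i k) (edge_length r j k).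

(* Each face having i as a vertex is {i, j, k} for exactly one pair j < k. *)
Definition curvature r i : R :=
  2 * pi -
  \sum_(j < N) \sum_(k < N | (j < k)%N && ([set i; j; k] \in faces T))
     inner_angle r i j k.

Definition alpha_curvature (alpha : R) r i : R :=
  curvature r i / powR (r 0 i) alpha.

Definition constant_alpha_curvature (alpha : R) r : Prop :=
  is_metric r /\
  forall i j, alpha_curvature alpha r i = alpha_curvature alpha r j.

End CirclePacking.

(* Main.v *)
Require Import Defs.
From mathcomp Require Import classical_sets topology normedtype sequences.
From mathcomp Require Import derive realfun.
From mathcomp Require Import all_boot all_order all_algebra ring lra.
From mathcomp Require Import reals exp trigo.
Import Order.TTheory GRing.Theory Num.Theory.
Import numFieldNormedType.Exports.
Local Open Scope ring_scope.
Set Implicit Arguments.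
Unset Strict Implicit.
Unset Printing Implicit Defensive.

(** Write r' = r exp v, with v a function on the vertices; the claim is that v
    is constant.  Everything rests on the sign of the sum of
    v_i (K'_i - K_i).

    Upper bound.  Constant alpha-curvature and Gauss-Bonnet
    ([gauss_bonnet]) give K_i = 2 pi chi p_i, where p is the probability vector
    proportional to r_i^alpha.  As alpha v_i = ln r'_i^alpha - ln r_i^alpha and
    ln is increasing, alpha times the sum of v_i (p'_i - p_i) is nonnegative
    ([log_weights_monotone]).  Together with alpha chi <= 0 this makes the sum
    of v_i (K'_i - K_i) at most 0.

    Lower bound.  That sum splits into contributions of the faces
    ([weighted_curvature]), so it is enough to study one triangle: the angles
    satisfy v . (theta' - theta) <= 0, strictly unless v is constant on the
    triangle ([angle_pairing_decreasing]).  Hence the sum is nonnegative, and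
    if it vanishes then v is constant on every face, so constant by
    connectedness ([curvature_rigidity]).

    The triangle.  Follow h(t) = v . theta(r exp (t v)) from t = 0 to t = 1.  At
    a time when the triangle is nondegenerate, h' is, up to a positive factor,
    minus a quadratic form in the differences of v whose coefficients are
    explicit ([angle_var_dirichlet]); its determinant factors as the squared
    area times a polynomial that is positive when the inversive distances are
    nonnegative ([conductance_det]), and this makes it definite
    ([dirichlet_conductance_gt0]).  The set of metrics need not be convex
    in the logarithms of the radii, so the path may leave it.  The cosines are therefore clamped to [-1, 1], which
    extends the angles continuously; at a degenerate time each of them is 0 or
    pi, so h lies in a finite set.  A continuous function that decreases
    wherever its value is outside a finite set is nonincreasing
    ([nonincreasing_off_finite_values]): it cannot cross upwards an interval of
    values that avoids this set. *)

(** * Quadratic form of a triangle *)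

Section Conductances.
Variable R : realFieldType.
Implicit Types x y z p q s A B C : R.

(** 16 times the squared area of the triangle with squared side lengths A, B
    and C. *)
Definition heron A B C := 2 * (A * B + B * C + C * A) - A ^+ 2 - B ^+ 2 - C ^+ 2.

(** Squared distance between the centres of two circles of radii y and z at
    inversive distance p. *)
Definition sqside y z p := y ^+ 2 + z ^+ 2 + 2 * y * z * p.

(** For three circles of radii x, y, z with inversive distances p (between y
    and z), q and s, the quotient of this number by 2 (sqside y z p) is 4 times
    the area times the derivative of the angle at y with respect to ln z.  It
    has the sign of the distance, counted positively on the inner side, from
    the power centre of the circles to the side that joins y and z; in
    particular it can be negative. *)
Definition conductance x y z p q s :=
  4 * y * z * (y * z * (1 - p ^+ 2) + x * y * (q + p * s) + x * z * (s + p * q)).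

(** Up to positive factors the left-hand side is a principal 2 by 2 minor of the
    matrix of the derivatives of the angles; it is positive when the power
    centre lies inside the circumscribed circle.  The factorization separates
    nondegeneracy, in [heron], from a factor that is visibly positive for
    nonnegative inversive distances. *)
Lemma conductance_det x y z p q s :
  let A := sqside y z p in let B := sqside z x q in let C := sqside x y s in
  let a := conductance x y z p q s in
  let b := conductance y z x q s p in
  let c := conductance z x y s p q in
  A * b * c + B * c * a + C * a * b = 4 * x * y * z * heron A B C *
  (2 * x * y * z * (1 + p * q * s) + x * (y ^+ 2 + z ^+ 2) * (p + q * s)
   + y * (z ^+ 2 + x ^+ 2) * (q + s * p) + z * (x ^+ 2 + y ^+ 2) * (s + p * q)).
Proof. by rewrite /= /sqside /conductance /heron; ring. Qed.

Lemma sqside_gt0 y z p : 0 < y -> 0 < z -> 0 <= p -> 0 < sqside y z p.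
Proof.
move=> y0 z0 p0; rewrite /sqside ltr_wpDr ?addr_gt0 ?exprn_gt0//.
by rewrite mulr_ge0// ltW// !mulr_gt0.
Qed.

(** Dirichlet energy of the function (u, v, w) on the vertices of a triangle
    whose opposite edges have conductances a, b, c of any sign. *)
Definition dirichlet (a b c u v w : R) :=
  a * (v - w) ^+ 2 + b * (w - u) ^+ 2 + c * (u - v) ^+ 2.

Lemma dirichlet_cycle a b c u v w : dirichlet b c a v w u = dirichlet a b c u v w.
Proof. by rewrite /dirichlet; ring. Qed.

(** Modulo constants the energy is a binary form; [b + c] is a diagonal entry
    and [a * b + b * c + c * a] its determinant. *)
Lemma dirichlet_gt0 a b c u v w : 0 < b + c -> 0 < a * b + b * c + c * a ->
  ~~ [&& u == v & v == w] -> 0 < dirichlet a b c u v w.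
Proof.
move=> bc D nuvw.
have E : (b + c) * dirichlet a b c u v w =
  ((b + c) * u - b * w - c * v) ^+ 2 + (a * b + b * c + c * a) * (v - w) ^+ 2.
  by rewrite /dirichlet; ring.
rewrite -(pmulr_rgt0 _ bc) E.
have [vw|vw] := eqVneq v w.
  rewrite vw eqxx andbT in nuvw.
  have -> : (b + c) * u - b * w - c * v = (b + c) * (u - w) by rewrite vw; ring.
  rewrite vw subrr expr0n mulr0 addr0 lt0r sqr_ge0 andbT expf_neq0//.
  by rewrite mulf_neq0 ?subr_eq0// gt_eqF.
by rewrite ltr_wpDl ?sqr_ge0// mulr_gt0// lt0r sqr_ge0 andbT expf_neq0 ?subr_eq0.
Qed.

(** Derivative of [sqside y z p] when y and z have logarithmic derivatives m
    and n. *)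
Definition sqside_var y z p (m n : R) :=
  2 * y ^+ 2 * m + 2 * z ^+ 2 * n + 2 * y * z * p * (m + n).

(** Derivative of the angle opposite to A, multiplied by [sqrt (heron A B C)],
    when the squared sides have derivatives A', B', C'. *)
Definition angle_var A B C A' B' C' :=
  A' - (A + B - C) / (2 * B) * B' - (A + C - B) / (2 * C) * C'.

Section Triangle.
Variables (x y z p q s : R).
Hypotheses (x0 : 0 < x) (y0 : 0 < y) (z0 : 0 < z).
Hypotheses (p0 : 0 <= p) (q0 : 0 <= q) (s0 : 0 <= s).
Let A := sqside y z p.
Let B := sqside z x q.
Let C := sqside x y s.
Let a := conductance x y z p q s / (2 * A).
Let b := conductance y z x q s p / (2 * B).
Let c := conductance z x y s p q / (2 * C).
Hypothesis h0 : 0 < heron A B C.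

Let A0 : 0 < A. Proof. exact: sqside_gt0. Qed.
Let B0 : 0 < B. Proof. exact: sqside_gt0. Qed.
Let C0 : 0 < C. Proof. exact: sqside_gt0. Qed.

(** When the angles at y and z are not obtuse, enlarging the circle at x
    decreases the angle at x: the identity in the proof writes [b + c] with the
    cosines of these two angles and the derivatives of the two sides at x. *)
Lemma conductance_sum_gt0 : 0 <= A + B - C -> 0 <= A + C - B -> 0 < b + c.
Proof.
move=> h1 h2.
have -> : b + c = (A + B - C) * (B + x ^+ 2 - z ^+ 2) / (2 * B)
               + (A + C - B) * (C + x ^+ 2 - y ^+ 2) / (2 * C).
  have := B0; have := C0; rewrite /b /c /conductance /A /B /C /sqside => c1 b1.
  by field; rewrite !gt_eqF.
have Bx : 0 < (B + x ^+ 2 - z ^+ 2) / (2 * B).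
  rewrite divr_gt0 ?mulr_gt0//.
  have -> : B + x ^+ 2 - z ^+ 2 = 2 * x ^+ 2 + 2 * (z * x * q) by rewrite /B /sqside; ring.
  apply: ltr_wpDr; first by rewrite !mulr_ge0// ltW.
  by rewrite mulr_gt0 ?exprn_gt0.
have Cx : 0 < (C + x ^+ 2 - y ^+ 2) / (2 * C).
  rewrite divr_gt0 ?mulr_gt0//.
  have -> : C + x ^+ 2 - y ^+ 2 = 2 * x ^+ 2 + 2 * (x * y * s) by rewrite /C /sqside; ring.
  apply: ltr_wpDr; first by rewrite !mulr_ge0// ltW.
  by rewrite mulr_gt0 ?exprn_gt0.
rewrite -!mulrA.
move: h2; rewrite le_eqVlt => /predU1P[h2|h2].
  by rewrite -h2 mul0r addr0 mulr_gt0//; move: A0; lra.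
apply: ltr_wpDl; last exact: mulr_gt0.
by rewrite mulr_ge0// ltW.
Qed.

Lemma conductance_det_gt0 : 0 < a * b + b * c + c * a.
Proof.
have -> : a * b + b * c + c * a =
    (A * conductance y z x q s p * conductance z x y s p q
     + B * conductance z x y s p q * conductance x y z p q s
     + C * conductance x y z p q s * conductance y z x q s p)
    / (4 * A * B * C).
  by rewrite /a /b /c; field; rewrite !gt_eqF.
rewrite divr_gt0 ?mulr_gt0// conductance_det -/A -/B -/C.
apply: mulr_gt0; first by rewrite !mulr_gt0.
have pos (t u v k l m : R) : 0 < t -> 0 <= k -> 0 <= l -> 0 <= m ->
  0 <= t * (u ^+ 2 + v ^+ 2) * (k + l * m).
  by move=> *; rewrite !mulr_ge0 ?addr_ge0 ?sqr_ge0 ?mulr_ge0// ltW.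
do 3 (apply: ltr_wpDr; first exact: pos).
by rewrite !mulr_gt0// ltr_wpDr// !mulr_ge0.
Qed.

(** The matrix of the derivatives of the angles in the logarithms of the radii
    is symmetric, and its rows sum to 0 because a homothety preserves angles;
    so it is minus the Laplacian of a weighted triangle. *)
Lemma angle_var_dirichlet u v w :
  let A' := sqside_var y z p v w in
  let B' := sqside_var z x q w u in
  let C' := sqside_var x y s u v in
  u * angle_var A B C A' B' C' + v * angle_var B C A B' C' A'
  + w * angle_var C A B C' A' B' = - dirichlet a b c u v w.
Proof.
have := A0; have := B0; have := C0.
rewrite /= /a /b /c /conductance /A /B /C => c1 b1 a1.
rewrite /angle_var /dirichlet /sqside_var; rewrite /sqside in a1 b1 c1 *.
by field; rewrite !gt_eqF.
Qed.

End Triangle.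

(** At most one angle is obtuse, so the roles of the vertices can be permuted
    to make [conductance_sum_gt0] applicable. *)
Lemma dirichlet_conductance_gt0 x y z p q s u v w :
  0 < x -> 0 < y -> 0 < z -> 0 <= p -> 0 <= q -> 0 <= s ->
  let A := sqside y z p in let B := sqside z x q in let C := sqside x y s in
  0 < heron A B C -> ~~ [&& u == v & v == w] ->
  0 < dirichlet (conductance x y z p q s / (2 * A))
        (conductance y z x q s p / (2 * B))
        (conductance z x y s p q / (2 * C)) u v w.
Proof.
move=> x0 y0 z0 p0 q0 s0 A B C h nuvw.
have A0 : 0 < A by exact: sqside_gt0.
have B0 : 0 < B by exact: sqside_gt0.
have C0 : 0 < C by exact: sqside_gt0.
have D := conductance_det_gt0 x0 y0 z0 p0 q0 s0 h.
have [ABC|ABC] := leP 0 (A + B - C); last first.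
  rewrite -2!dirichlet_cycle; apply: dirichlet_gt0.
  - by apply: (@conductance_sum_gt0 z x y s p q) => //; rewrite -/A -/B -/C; lra.
  - by move: D; rewrite -/A -/B -/C; congr (_ < _); ring.
  - by apply: contra nuvw => /andP[/eqP-> /eqP->]; rewrite !eqxx.
have [ACB|ACB] := leP 0 (A + C - B).
  by apply: dirichlet_gt0 => //; exact: conductance_sum_gt0.
rewrite -dirichlet_cycle; apply: dirichlet_gt0.
- by apply: (@conductance_sum_gt0 y z x q s p) => //; rewrite -/A -/B -/C; lra.
- by move: D; rewrite -/A -/B -/C; congr (_ < _); ring.
- by apply: contra nuvw => /andP[/eqP-> /eqP->]; rewrite !eqxx.
Qed.

End Conductances.

(** * Functions decreasing off finitely many values *)

Section RealFunctions.
Local Open Scope classical_set_scope.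
Variable R : realType.
Implicit Types (f h : R -> R) (a b t : R).

Lemma is_derive_lt0_right f t d : is_derive t 1 f d -> d < 0 ->
  forall b, t < b -> exists2 u, t < u < b & f u < f t.
Proof.
move=> /is_derive1_caratheodory[g [fE gc gt]] d0 b tb.
have g0 : \forall z \near t, g z < 0 by apply: (cvgr_lt (g t) gc); rewrite gt.
have [u] : exists u, [/\ g u < 0, t < u & u < b].
  have : \forall z \near t^'+, [/\ g z < 0, t < z & z < b].
    near=> z; split.
    - by near: z; apply: cvg_within.
    - by near: z; exact: nbhs_right_gt.
    - by near: z; exact: nbhs_right_lt.
  by move=> H; have [u ?] := @filter_ex _ _ (at_right_proper_filter _) _ H; exists u.
case=> gu tu ub; exists u; rewrite ?tu// -subr_lt0 fE.
by rewrite nmulr_rlt0// subr_gt0.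
Unshelve. all: by end_near. Qed.

Lemma itv_avoiding (S : seq R) a b : a < b ->
  exists c d, [/\ a <= c, c < d, d <= b & forall s, s \in S -> ~~ (c < s < d)].
Proof.
elim: S a b => [|s S IH] a b ab; first by exists a, b; split.
have [c [d [ac cd db cdS]]] := IH _ _ ab.
have [csd|csd] := boolP (c < s < d); last first.
  by exists c, d; split=> // x; rewrite inE => /predU1P[->//|/cdS].
have /andP[cs sd] := csd.
exists c, s; split=> //; first exact: le_trans (ltW sd) db.
move=> x; rewrite inE => /predU1P[->|/cdS]; first by rewrite ltxx andbF.
by apply: contra => /andP[-> /lt_trans ->].
Qed.

(** Suppose h b > h a and choose an interval ]c, d[ of values between them that
    avoids S.  Subtracting a small slope from h gives f with negative derivative
    whenever h is outside S.  Let s be the last time when f is at most a level y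
    in the lower part of ]c, d[.  Then h s is in ]c, d[, so f decreases strictly
    at s, although f > y = f s afterwards. *)
Lemma nonincreasing_off_finite_values (S : seq R) h a b : continuous h ->
  (forall t, h t \in S \/ exists2 d, is_derive t 1 h d & d <= 0) ->
  a <= b -> h b <= h a.
Proof.
move=> ch hS; rewrite le_eqVlt => /predU1P[->//|ab].
rewrite leNgt; apply/negP => hab.
have [c [d [hac cd dhb cdS]]] := itv_avoiding S hab.
(* The slope e changes f by half of d - c over [a, b], so that a level y at one
   quarter of ]c, d[ is still crossed and h s = y + e * (s - a) stays in it. *)
pose e := (d - c) / 2 / (b - a).
have e0 : 0 < e by rewrite !divr_gt0// subr_gt0.
have eba : e * (b - a) = (d - c) / 2 by rewrite divfK// subr_eq0 gt_eqF.
pose f t := h t - e * (t - a).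
have cf : continuous f.
  move=> t; apply: cvgB; first exact: ch.
  apply: cvgM; first exact: cvg_cst.
  by apply: cvgB; [exact: cvg_id|exact: cvg_cst].
pose y := c + (d - c) / 4.
pose E := [set t | [/\ a <= t, t <= b & f t <= y]].
have Ea : E a by split=> //; [exact: ltW|rewrite /f subrr mulr0 subr0 /y; lra].
have Eub : ubound E b by move=> t [].
have hub : has_ubound E by exists b.
have E0 : E !=set0 by exists a.
have Es : has_sup E by split.
pose s := sup E.
have as_ : a <= s by exact: (ub_le_sup hub Ea).
have sb_ : s <= b by exact: (ge_sup E0 Eub).
have fb : y < f b by rewrite /f eba /y; lra.
have fsy : f s <= y.
  rewrite leNgt; apply/negP => ys.
  have : \forall t \near s, y < f t by exact: (cvgr_gt (f s) (cf s)).
  move=> /nbhs_ballP[r /= r0 rs].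
  have [t Et st] := sup_adherent r0 Es.
  have ts : t <= s by exact: (ub_le_sup hub Et).
  have : y < f t.
    by apply: rs; rewrite /ball/= ger0_norm ?subr_ge0//; rewrite ltrBlDl -ltrBlDr.
  by case: Et => _ _ /le_lt_trans/[apply]; rewrite ltxx.
have sb : s < b.
  by rewrite lt_neqAle sb_ andbT; apply: contraTneq fb => <-; rewrite -leNgt.
have fgt t : s < t <= b -> y < f t.
  move=> /andP[st tb]; rewrite ltNge; apply/negP => fty.
  have : E t by split=> //; apply: le_trans as_ (ltW st).
  by move=> Et; have := ub_le_sup hub Et; rewrite -/s leNgt st.
have ysf : y <= f s.
  rewrite leNgt; apply/negP => ys.
  have : \forall t \near s, f t < y by exact: (cvgr_lt (f s) (cf s)).
  move=> fy; have : \forall z \near s^'+, [/\ f z < y, s < z & z < b].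
    near=> z; split.
    - by near: z; apply: cvg_within.
    - by near: z; exact: nbhs_right_gt.
    - by near: z; exact: nbhs_right_lt.
  move=> H; have [z [fz sz zb]] := @filter_ex _ _ (at_right_proper_filter _) _ H.
  by have := fgt z; rewrite sz (ltW zb) => /(_ isT); rewrite ltNge (ltW fz).
have fs : h s = y + e * (s - a).
  by apply/eqP; rewrite -subr_eq eq_le; apply/andP.
have [hsS|[d' hd d0]] := hS s.
  have := cdS _ hsS; rewrite fs => /negP; apply.
  have : e * (s - a) <= e * (b - a) by rewrite ler_pM2l// lerB.
  have : 0 <= e * (s - a) by rewrite mulr_ge0 ?subr_ge0 // ltW.
  by rewrite eba /y => *; apply/andP; split; lra.
have fd : is_derive s 1 f (d' - e).
  by rewrite /f; apply: is_derive_eq; rewrite subr0 /GRing.scale/= mulr1.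
have [|u /andP[su ub] fu] := is_derive_lt0_right fd _ sb.
  by rewrite subr_lt0 (le_lt_trans d0).
have := fgt u; rewrite su (ltW ub) => /(_ isT).
by rewrite ltNge (le_trans (ltW fu)).
Unshelve. all: by end_near. Qed.

Definition clamp (x : R) := Num.max (-1) (Num.min 1 x).

Lemma clamp_itv x : -1 <= clamp x <= 1.
Proof. by rewrite /clamp le_max lexx/= ge_max ge_min lexx andbT; lra. Qed.

Lemma clamp_id x : -1 <= x <= 1 -> clamp x = x.
Proof. by move=> /andP[? ?]; rewrite /clamp min_r// max_r. Qed.

Lemma clamp_ge x : 1 <= x -> clamp x = 1.
Proof. by move=> x1; rewrite /clamp min_l// max_r//; lra. Qed.

Lemma clamp_le x : x <= -1 -> clamp x = -1.
Proof. by move=> x1; rewrite /clamp min_r ?max_l//; lra. Qed.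

(** At the endpoints -1 and 1 the arccosine is continuous only relative to the
    segment; clamping makes the continuity global. *)
Lemma continuous_acos_clamp : continuous (fun x => acos (clamp x)).
Proof.
have ac : {within `[(cos pi), (cos 0)], continuous (@acos R)}.
  apply: segment_can_ge_continuous; first exact: pi_ge0.
    by apply: continuous_subspaceT => x; exact: continuous_cos.
  by move=> x xpi; rewrite cosK.
rewrite cospi cos0 in ac.
move=> x; have cc : {for x, continuous clamp}.
  apply: continuous_max; first exact: cst_continuous.
  by apply: continuous_min; [exact: cst_continuous|exact: cvg_id].
move/subspace_continuousP : ac => /(_ (clamp x)).
rewrite /= in_itv/= clamp_itv => /(_ isT); apply: cvg_comp.
move=> A /cc; rewrite /nbhs/= !nbhs_simpl/=; apply: filterS => t; apply.
by rewrite /= in_itv/= clamp_itv.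
Qed.

End RealFunctions.

(** * Angles as functions of squared side lengths *)

Section Angles.
Variable R : realType.
Implicit Types a b c x A B C : R.

Definition cosine A B C := (B + C - A) / (2 * (Num.sqrt B * Num.sqrt C)).

(** The angle opposite to the side of squared length A, extended by 0 or pi to
    the A, B, C that violate the triangle inequality. *)
Definition angle A B C := acos (clamp (cosine A B C)).

Lemma heron_cycle A B C : heron B C A = heron A B C.
Proof. by rewrite /heron; ring. Qed.

Lemma sqr_witness A : 0 < A -> exists2 a : R, 0 < a & A = a ^+ 2.
Proof. by move=> A0; exists (Num.sqrt A); rewrite ?sqrtr_gt0// sqr_sqrtr// ltW. Qed.

Lemma sqrt_sqr a : 0 < a -> Num.sqrt (a ^+ 2) = a.
Proof. by move=> a0; rewrite sqrtr_sqr gtr0_norm. Qed.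

Lemma sqrt_div_sqr A a : 0 < a -> Num.sqrt (A / a ^+ 2) = Num.sqrt A / a.
Proof.
move=> a0; have a2 : 0 <= a ^+ 2 by rewrite sqr_ge0.
by rewrite mulrC sqrtrM ?invr_ge0// sqrtrV// sqrt_sqr// mulrC.
Qed.

Lemma sin2_cosine A b c : 0 < b -> 0 < c ->
  1 - cosine A (b ^+ 2) (c ^+ 2) ^+ 2 =
  heron A (b ^+ 2) (c ^+ 2) / (2 * (b * c)) ^+ 2.
Proof.
move=> b0 c0; rewrite /cosine /heron !sqrt_sqr//; field.
by rewrite !gt_eqF.
Qed.

Lemma heron_gt0_cosine A B C : 0 < B -> 0 < C ->
  (0 < heron A B C) = (-1 < cosine A B C < 1).
Proof.
move=> /sqr_witness[b b0 ->] /sqr_witness[c c0 ->].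
have := sin2_cosine A b0 c0; set x := cosine _ _ _ => xE.
have -> : (0 < heron A (b ^+ 2) (c ^+ 2)) = (0 < 1 - x ^+ 2).
  by rewrite xE pmulr_lgt0// invr_gt0 exprn_gt0// !mulr_gt0.
by rewrite subr_gt0 -real_normK ?num_real// expr_lt1// ltr_norml.
Qed.

Lemma angle_nondegenerate A B C : 0 < B -> 0 < C -> 0 < heron A B C ->
  angle A B C = acos (cosine A B C).
Proof.
move=> B0 C0; rewrite heron_gt0_cosine// => /andP[x1 x2].
by rewrite /angle clamp_id// !ltW.
Qed.

(** This confines the angles of degenerate triangles to finitely many values,
    as required by [nonincreasing_off_finite_values]. *)
Lemma angle_degenerate A B C : 0 < B -> 0 < C -> heron A B C <= 0 ->
  exists e : bool, angle A B C = pi * e%:R.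
Proof.
move=> B0 C0; rewrite leNgt heron_gt0_cosine// /angle => x1.
have [x0|x0] := ltP (-1) (cosine A B C).
  exists false; rewrite mulr0 clamp_ge ?acos1//.
  by move: x1; rewrite x0 -leNgt.
by exists true; rewrite mulr1 clamp_le// acosN1.
Qed.

Lemma sum_angle A B C : 0 < A -> 0 < B -> 0 < C -> 0 < heron A B C ->
  angle A B C + angle B C A + angle C A B = pi.
Proof.
move=> A0 B0 C0 h.
have h' : 0 < heron B C A by rewrite heron_cycle.
have h'' : 0 < heron C A B by rewrite heron_cycle.
rewrite !angle_nondegenerate//.
move: A0 B0 C0 h h' h'' => /sqr_witness[a a0 ->] /sqr_witness[b b0 ->].
move=> /sqr_witness[c c0 ->] h h' h''.
have xE : cosine (a ^+ 2) (b ^+ 2) (c ^+ 2) =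
    (b ^+ 2 + c ^+ 2 - a ^+ 2) / (2 * (b * c)).
  by rewrite /cosine !sqrt_sqr.
have yE : cosine (b ^+ 2) (c ^+ 2) (a ^+ 2) =
    (c ^+ 2 + a ^+ 2 - b ^+ 2) / (2 * (c * a)).
  by rewrite /cosine !sqrt_sqr.
have zE : cosine (c ^+ 2) (a ^+ 2) (b ^+ 2) =
    (a ^+ 2 + b ^+ 2 - c ^+ 2) / (2 * (a * b)).
  by rewrite /cosine !sqrt_sqr.
have sx := sin2_cosine (a ^+ 2) b0 c0.
have sy := sin2_cosine (b ^+ 2) c0 a0.
move: (h) (h') (h''); rewrite !heron_gt0_cosine ?exprn_gt0//.
set x := cosine (a ^+ 2) _ _ in xE sx *.
set y := cosine (b ^+ 2) _ _ in yE sy *.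
set z := cosine (c ^+ 2) _ _ in zE *.
move=> /andP[xl xu] /andP[yl yu] /andP[zl zu].
have xI : -1 <= x <= 1 by rewrite !ltW.
have yI : -1 <= y <= 1 by rewrite !ltW.
have zI : -1 <= z <= 1 by rewrite !ltW.
have xy0 : 0 <= x + y.
  have -> : x + y = (a + b) * (c ^+ 2 - (a - b) ^+ 2) / (2 * (a * b * c)).
    by rewrite xE yE; field; rewrite !gt_eqF.
  have cab : 0 < c ^+ 2 - (a - b) ^+ 2.
    by move: zu; rewrite zE ltr_pdivrMr ?mulr_gt0// => zu; nra.
  by rewrite ltW// divr_gt0// !mulr_gt0// addr_gt0.
(* Both sides have the same cosine; x + y >= 0 is what keeps the sum of the
   first two angles in [0, pi], where the cosine is injective. *)
have NI (w : R) : -1 <= w <= 1 -> -1 <= - w <= 1.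
  by move=> /andP[? ?]; apply/andP; split; lra.
rewrite -[RHS](subrK (acos z)) -acosN//; congr (_ + _); apply: cos_inj.
- rewrite in_itv/= addr_ge0 ?acos_ge0//= -lerBrDr -acosN// leNgt.
  rewrite -ltr_cos ?in_itv/= ?acos_ge0 ?acos_lepi ?NI//.
  by rewrite !acosK ?in_itv/= ?NI// -leNgt -subr_ge0 opprK.
- by rewrite in_itv/= acos_ge0 ?acos_lepi ?NI.
rewrite cosD !sin_acos// !acosK ?in_itv/= ?NI// sx sy.
rewrite (heron_cycle (a ^+ 2)) !sqrt_div_sqr ?mulr_gt0//.
set s := Num.sqrt _; have sE : s ^+ 2 = heron (a ^+ 2) (b ^+ 2) (c ^+ 2).
  by rewrite sqr_sqrtr// ltW.
transitivity (x * y - s ^+ 2 / (4 * a * b * c ^+ 2)).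
  by congr (_ - _); field; rewrite !gt_eqF.
rewrite sE xE yE zE /heron; field.
by rewrite !gt_eqF.
Qed.

Lemma is_derive_acos_clamp x : -1 < x < 1 ->
  is_derive x 1 (fun y : R => acos (clamp y)) (- (Num.sqrt (1 - x ^+ 2))^-1).
Proof.
move=> xI; apply: near_eq_is_derive (is_derive1_acos xI).
have /near_in_itvoo xn : x \in `](-1), 1[%R by rewrite in_itv.
near=> y; rewrite clamp_id//.
have : y \in `](-1), 1[%R by near: y.
by rewrite in_itv/= => /andP[? ?]; rewrite !ltW.
Unshelve. all: by end_near. Qed.

Lemma is_derive_angle (A B C : R -> R) (t A' B' C' : R) :
  is_derive t 1 A A' -> is_derive t 1 B B' -> is_derive t 1 C C' ->
  0 < B t -> 0 < C t -> 0 < heron (A t) (B t) (C t) ->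
  is_derive t 1 (fun t => angle (A t) (B t) (C t))
   (angle_var (A t) (B t) (C t) A' B' C' / Num.sqrt (heron (A t) (B t) (C t))).
Proof.
move=> dA dB dC B0 C0 h0.
have dsB := is_derive1_comp (is_derive1_sqrt B0) dB.
have dsC := is_derive1_comp (is_derive1_sqrt C0) dC.
have n0 : 2 * (Num.sqrt (B t) * Num.sqrt (C t)) != 0.
  by rewrite gt_eqF// !mulr_gt0// sqrtr_gt0.
have := h0; rewrite heron_gt0_cosine// => xI.
have dx : is_derive t 1 (fun t => cosine (A t) (B t) (C t))
  ((B' + C' - A') / (2 * (Num.sqrt (B t) * Num.sqrt (C t)))
   - (B t + C t - A t) / (4 * (Num.sqrt (B t) * Num.sqrt (C t))) * (B' / B t + C' / C t)).
  rewrite /cosine.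
  have dV := is_deriveV (f := fun t => 2 * (Num.sqrt (B t) * Num.sqrt (C t))) n0.
  apply: is_derive_eq.
  have [b b0 ->] := sqr_witness B0; have [c c0 ->] := sqr_witness C0.
  by rewrite /GRing.scale/= !sqrt_sqr//; field; rewrite !gt_eqF.
have := is_derive1_comp (g := fun t => cosine (A t) (B t) (C t))
  (is_derive_acos_clamp xI) dx.
move=> /is_derive_eq; apply.
move: h0 xI {dx n0}.
have [b b0 ->] := sqr_witness B0; have [c c0 ->] := sqr_witness C0 => h0 xI.
rewrite sin2_cosine// sqrt_div_sqr ?mulr_gt0// !sqrt_sqr//.
by rewrite /angle_var; field; rewrite !gt_eqF// sqrtr_gt0.
Qed.

End Angles.

(** * Monotonicity of the angles of one triangle *)

Section TriangleMonotonicity.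
Local Open Scope classical_set_scope.
Variable R : realType.

Lemma continuous_angle (A B C : R -> R) : continuous A -> continuous B -> continuous C ->
  (forall t, 0 < B t) -> (forall t, 0 < C t) ->
  continuous (fun t => angle (A t) (B t) (C t)).
Proof.
move=> cA cB cC B0 C0 t; rewrite /angle.
apply: (@continuous_comp _ _ _ (fun t => cosine (A t) (B t) (C t))
  (fun x => acos (clamp x))); last exact: continuous_acos_clamp.
rewrite /cosine; apply: cvgM.
  by apply: cvgB; [apply: cvgD; [exact: cB|exact: cC]|exact: cA].
apply: cvgV; first by rewrite gt_eqF// !mulr_gt0// sqrtr_gt0.
apply: cvgM; first exact: cvg_cst.
apply: cvgM.
  exact: (continuous_comp (cB t) (@sqrt_continuous R _)).
exact: (continuous_comp (cC t) (@sqrt_continuous R _)).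
Qed.

Section Path.
Variables (x y z p q s u v w : R).
Hypotheses (x0 : 0 < x) (y0 : 0 < y) (z0 : 0 < z).
Hypotheses (p0 : 0 <= p) (q0 : 0 <= q) (s0 : 0 <= s).

Let dilate (a m : R) t := a * expR (m * t).
Let X := dilate x u. Let Y := dilate y v. Let Z := dilate z w.
Let A t := sqside (Y t) (Z t) p.
Let B t := sqside (Z t) (X t) q.
Let C t := sqside (X t) (Y t) s.

Let dilate_gt0 (a m t : R) : 0 < a -> 0 < dilate a m t.
Proof. by move=> a0; rewrite /dilate mulr_gt0// expR_gt0. Qed.

Let is_derive_sqside (b c m n r t : R) :
  is_derive t 1 (fun t : R => sqside (dilate b m t) (dilate c n t) r)
    (sqside_var (dilate b m t) (dilate c n t) r m n).
Proof.
have dp (a k : R) : is_derive t 1 (dilate a k) (k * dilate a k t).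
  rewrite /dilate.
  have de : is_derive t 1 (fun t : R => expR (k * t)) (expR (k * t) * k).
    apply: (@is_derive1_comp _ expR (fun t : R => k * t)).
    by apply: is_derive_eq; rewrite /GRing.scale/= mulr1.
  by apply: is_derive_eq; rewrite /GRing.scale/=; ring.
by rewrite /sqside; apply: is_derive_eq; rewrite /GRing.scale/= /sqside_var; ring.
Qed.

Let continuous_sqside (b c m n r : R) :
  continuous (fun t : R => sqside (dilate b m t) (dilate c n t) r).
Proof.
move=> t; apply/differentiable_continuous/derivable1_diffP.
by case: (is_derive_sqside b c m n r t).
Qed.

Definition angle_pairing (A B C : R) :=
  u * angle A B C + v * angle B C A + w * angle C A B.
Let h t := angle_pairing (A t) (B t) (C t).

Let A0 (t : R) : 0 < A t. Proof. by apply: sqside_gt0 => //; exact: dilate_gt0. Qed.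
Let B0 (t : R) : 0 < B t. Proof. by apply: sqside_gt0 => //; exact: dilate_gt0. Qed.
Let C0 (t : R) : 0 < C t. Proof. by apply: sqside_gt0 => //; exact: dilate_gt0. Qed.

Lemma continuous_pairing : continuous h.
Proof.
have cA : continuous A by exact: continuous_sqside.
have cB : continuous B by exact: continuous_sqside.
have cC : continuous C by exact: continuous_sqside.
move=> t; rewrite /h /angle_pairing.
apply: cvgD; first apply: cvgD.
- by apply: cvgM; [exact: cvg_cst|exact: (@continuous_angle A B C)].
- by apply: cvgM; [exact: cvg_cst|exact: (@continuous_angle B C A)].
- by apply: cvgM; [exact: cvg_cst|exact: (@continuous_angle C A B)].
Qed.

Lemma is_derive_pairing_lt0 (t : R) : 0 < heron (A t) (B t) (C t) -> ~~ [&& u == v & v == w] ->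
  exists2 d, is_derive t 1 h d & d < 0.
Proof.
move=> h0 nuvw.
have dA := is_derive_sqside y z v w p t.
have dB := is_derive_sqside z x w u q t.
have dC := is_derive_sqside x y u v s t.
have dh1 := is_derive_angle dA dB dC (B0 t) (C0 t) h0.
have dh2 := is_derive_angle dB dC dA (C0 t) (A0 t).
have dh3 := is_derive_angle dC dA dB (A0 t) (B0 t).
rewrite heron_cycle in dh2; rewrite -heron_cycle in dh3.
have {}dh2 := dh2 h0; have {}dh3 := dh3 h0.
eexists; first by rewrite /h /angle_pairing; apply: is_derive_eq.
rewrite /GRing.scale/= !mulrA -!mulrDl.
rewrite pmulr_llt0 ?invr_gt0 ?sqrtr_gt0// angle_var_dirichlet ?dilate_gt0// oppr_lt0.
by apply: dirichlet_conductance_gt0 => //; exact: dilate_gt0.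
Qed.

(** The strict inequality comes from the derivative at time 0, where the
    triangle is nondegenerate; after that, h does not increase, whether or not
    the triangle degenerates on the way. *)
Lemma angle_pairing_decreasing :
  0 < heron (sqside y z p) (sqside z x q) (sqside x y s) -> ~~ [&& u == v & v == w] ->
  angle_pairing (sqside (y * expR v) (z * expR w) p) (sqside (z * expR w) (x * expR u) q)
      (sqside (x * expR u) (y * expR v) s)
  < angle_pairing (sqside y z p) (sqside z x q) (sqside x y s).
Proof.
have -> : sqside y z p = A 0 by rewrite /A /Y /Z /dilate !mulr0 expR0 !mulr1.
have -> : sqside z x q = B 0 by rewrite /B /Z /X /dilate !mulr0 expR0 !mulr1.
have -> : sqside x y s = C 0 by rewrite /C /X /Y /dilate !mulr0 expR0 !mulr1.
have -> : sqside (y * expR v) (z * expR w) p = A 1 by rewrite /A /Y /Z /dilate !mulr1.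
have -> : sqside (z * expR w) (x * expR u) q = B 1 by rewrite /B /Z /X /dilate !mulr1.
have -> : sqside (x * expR u) (y * expR v) s = C 1 by rewrite /C /X /Y /dilate !mulr1.
move=> h0 nuvw; rewrite -[ltLHS]/(h 1) -[ltRHS]/(h 0).
have [d dh d0] := is_derive_pairing_lt0 h0 nuvw.
have [t /andP[t0 t1] ht] := is_derive_lt0_right dh d0 (@ltr01 R).
apply: le_lt_trans ht.
(* F lists the values of the pairing when every angle is 0 or pi. *)
pose F (e : bool * bool * bool) :=
  u * (pi * e.1.1%:R) + v * (pi * e.1.2%:R) + w * (pi * e.2%:R) : R.
pose S := [seq F e | e <- enum {: bool * bool * bool}].
apply: (@nonincreasing_off_finite_values _ S); [exact: continuous_pairing| |exact: ltW].
move=> r; have [hr|hr] := ltP 0 (heron (A r) (B r) (C r)).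
  by right; have [e ? ?] := is_derive_pairing_lt0 hr nuvw; exists e => //; exact: ltW.
left; rewrite /h /angle_pairing.
have [a ->] := angle_degenerate (B0 r) (C0 r) hr.
have [b ->] : exists e : bool, angle (B r) (C r) (A r) = pi * e%:R.
  by apply: angle_degenerate => //; rewrite heron_cycle.
have [c ->] : exists e : bool, angle (C r) (A r) (B r) = pi * e%:R.
  by apply: angle_degenerate => //; rewrite -heron_cycle.
by apply: (map_f F (x := (a, b, c))); rewrite mem_enum.
Qed.

End Path.
End TriangleMonotonicity.

(** * Counting flags of a triangulated surface *)

Lemma cards3_neq (T : finType) (i j k : T) : #|[set i; j; k]| = 3%N ->
  [/\ i != j, j != k & k != i].
Proof.
rewrite setUC cardsU1 cards2 !inE negb_or.
by case: eqP; case: eqP; case: eqP => // *; split=> //; apply/eqP => // /esym.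
Qed.

Lemma set3_eqE (T : finType) (f : {set T}) (i j k : T) : #|f| = 3%N ->
  ([set i; j; k] == f) = [&& i \in f, j \in f :\ i & k \in f :\ i :\ j].
Proof.
move=> f3; apply/eqP/and3P => [fE|[fi fj fk]].
  have [ij jk ki] : [/\ i != j, j != k & k != i] by apply: cards3_neq; rewrite fE.
  by rewrite -fE !inE !eqxx (eq_sym j i) (eq_sym k j) ij jk ki !orbT.
have : #|f :\ i :\ j :\ k| = 0%N.
  by move: f3; rewrite (cardsD1 i f) fi (cardsD1 j) fj (cardsD1 k) fk => -[].
move/eqP; rewrite cards_eq0 => /eqP D.
by rewrite -(setD1K fi) -(setD1K fj) -(setD1K fk) D setU0 setUA.
Qed.

Section Count.
Variables (N : nat) (T : surface_triangulation N).
Local Open Scope nat_scope.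

(** A face is {i, j, k} for 3! ordered triples (i, j, k). *)
Lemma count_flags :
  \sum_(i < N) \sum_(j < N) \sum_(k < N | [set i; j; k] \in faces T) 1 =
  6 * #|faces T|.
Proof.
have -> : 6 * #|faces T| = \sum_(f in faces T) 6 by rewrite sum_nat_const mulnC.
transitivity (\sum_(f in faces T) \sum_(i < N) \sum_(j < N)
                \sum_(k < N | [set i; j; k] == f) 1).
  rewrite [RHS]exchange_big; apply: eq_bigr => i _.
  rewrite [RHS]exchange_big; apply: eq_bigr => j _.
  rewrite big_mkcond [RHS](exchange_big_dep xpredT)//=; apply: eq_bigr => k _.
  case: ifP => Fijk; last first.
    by rewrite big_pred0// => f; apply: contraFF Fijk => /andP[? /eqP->].
  rewrite (big_pred1 [set i; j; k])// => f.
  by rewrite /= eq_sym andbC; case: eqP => // ->.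
apply: eq_bigr => f /card_face f3.
transitivity (\sum_(i in f) \sum_(j in f :\ i) \sum_(k in f :\ i :\ j) 1).
  rewrite [RHS]big_mkcond; apply: eq_bigr => i _.
  case: ifP => fi; last first.
    by rewrite big1// => j _; rewrite big_pred0// => k; rewrite set3_eqE ?fi.
  rewrite [RHS]big_mkcond; apply: eq_bigr => j _.
  case: ifP => fj; first by apply: eq_bigl => k; rewrite set3_eqE// fi fj.
  by rewrite big_pred0// => k; rewrite set3_eqE// fi fj.
have c i : i \in f -> #|f :\ i| = 2.
  by move=> fi; move: f3; rewrite (cardsD1 i) fi => -[].
rewrite (eq_bigr (fun=> 2)); first by rewrite sum_nat_const f3.
move=> i fi; rewrite (eq_bigr (fun=> 1)); first by rewrite sum_nat_const c.
move=> j fj; rewrite sum1_card; move: (c i fi).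
by rewrite (cardsD1 j) fj => -[].
Qed.

(** Double counting of the incidences between edges and faces. *)
Lemma edges_faces : 2 * #|edges T| = 3 * #|faces T|.
Proof.
transitivity (\sum_(e in edges T) \sum_(f in faces T | e \subset f) 1).
  rewrite mulnC -sum_nat_const; apply: eq_bigr => e /two_faces <-.
  by rewrite -sum1_card; apply: eq_bigl => f; rewrite inE.
rewrite (exchange_big_dep (mem (faces T)))/=; last by move=> e f _ /andP[].
rewrite mulnC -sum_nat_const; apply: eq_bigr => f ff.
transitivity #|[set e : {set 'I_N} | e \subset f & #|e| == 2]|; last first.
  by rewrite cards_draws (card_face ff).
rewrite sum1dep_card; congr #|pred_of_set _|; apply/setP => e; rewrite !inE ff /=.
apply/andP/andP => [[ee ef]|[ef /eqP e2]].
  by rewrite ef (card_edge ee).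
by split=> //; exact: (edge_of_face ff ef e2).
Qed.

End Count.

(** * Weighted curvature sums and rigidity *)

Section Global.
Variables (R : realType) (N : nat) (T : surface_triangulation N).
Variable I : {set 'I_N} -> R.
Hypothesis hI : inversive_distance T I.
Implicit Types (r : 'rV[R]_N) (i j k : 'I_N) (v : 'I_N -> R).

Definition edge_sqlen r i j := sqside (r 0 i) (r 0 j) (I [set i; j]).

Lemma edge_sqlenC r i j : edge_sqlen r i j = edge_sqlen r j i.
Proof. by rewrite /edge_sqlen /sqside setUC; ring. Qed.

Lemma edge_lengthE r i j : edge_length I r i j = Num.sqrt (edge_sqlen r i j).
Proof. by []. Qed.

Lemma edge_lengthC r i j : edge_length I r i j = edge_length I r j i.
Proof. by rewrite !edge_lengthE edge_sqlenC. Qed.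

Lemma inner_angleC r i j k : inner_angle I r i j k = inner_angle I r i k j.
Proof.
rewrite /inner_angle (edge_lengthC r k j) /euclidean_angle; congr acos.
by congr (_ / _); ring.
Qed.

Lemma face_edge i j k : [set i; j; k] \in faces T -> [set i; j] \in edges T.
Proof.
move=> F; have [ij _ _] := cards3_neq (card_face F).
by apply: (edge_of_face F); [exact: subsetUl|rewrite cards2 ij].
Qed.

Lemma set3_cycle (i j k : 'I_N) : [set i; j; k] = [set j; k; i].
Proof. by rewrite -setUA setUC. Qed.

Lemma set3_swap (i j k : 'I_N) : [set i; j; k] = [set i; k; j].
Proof. by rewrite -!setUA [[set j] :|: _]setUC. Qed.

Lemma face_cycle i j k : [set i; j; k] \in faces T -> [set j; k; i] \in faces T.
Proof. by rewrite set3_cycle. Qed.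

Lemma edge_sqlen_gt0 r i j k : is_metric T I r -> [set i; j; k] \in faces T ->
  0 < edge_sqlen r i j.
Proof.
by move=> hr F; apply: sqside_gt0; [exact: hr.1|exact: hr.1|exact/hI/(face_edge F)].
Qed.

Lemma heron_metric r i j k : is_metric T I r -> [set i; j; k] \in faces T ->
  0 < heron (edge_sqlen r j k) (edge_sqlen r k i) (edge_sqlen r i j).
Proof.
move=> hr F; have [] := hr.2 _ _ _ F; rewrite (edge_lengthC r i k) !edge_lengthE.
have F2 := face_cycle F; have F3 := face_cycle F2.
have [a a0 ->] := sqr_witness (edge_sqlen_gt0 hr F).
have [b b0 ->] := sqr_witness (edge_sqlen_gt0 hr F2).
have [c c0 ->] := sqr_witness (edge_sqlen_gt0 hr F3).
rewrite !sqrt_sqr// => h1 h2 h3.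
have -> : heron (b ^+ 2) (c ^+ 2) (a ^+ 2) =
  (a + b + c) * (b + c - a) * (a + c - b) * (a + b - c) by rewrite /heron; ring.
by rewrite !mulr_gt0 ?subr_gt0 ?addr_gt0//; lra.
Qed.

Lemma inner_angleE r i j k : is_metric T I r -> [set i; j; k] \in faces T ->
  inner_angle I r i j k =
  angle (edge_sqlen r j k) (edge_sqlen r k i) (edge_sqlen r i j).
Proof.
move=> hr F.
have F2 := face_cycle F; have F3 := face_cycle F2.
have A0 := edge_sqlen_gt0 hr F2.
have B0 := edge_sqlen_gt0 hr F3.
have C0 := edge_sqlen_gt0 hr F.
rewrite angle_nondegenerate//; last exact: heron_metric.
rewrite /inner_angle /euclidean_angle (edge_lengthC r i k) !edge_lengthE /cosine.
by rewrite !sqr_sqrtr ?ltW//; congr acos; congr (_ / _); ring.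
Qed.

Lemma inner_angle_sum r i j k : is_metric T I r -> [set i; j; k] \in faces T ->
  inner_angle I r i j k + inner_angle I r j k i + inner_angle I r k i j = pi.
Proof.
move=> hr F.
have F2 := face_cycle F; have F3 := face_cycle F2.
rewrite !inner_angleE//; apply: sum_angle; last exact: heron_metric.
- exact: edge_sqlen_gt0 F2.
- exact: edge_sqlen_gt0 F3.
- exact: edge_sqlen_gt0 F.
Qed.

Lemma sum_cycle (G : 'I_N -> 'I_N -> 'I_N -> R) :
  \sum_i \sum_j \sum_k G j k i = \sum_i \sum_j \sum_k G i j k.
Proof.
by rewrite exchange_big; apply: eq_bigr => j _; exact: exchange_big.
Qed.

Lemma sum_upper (G : 'I_N -> 'I_N -> R) : (forall j k, G j k = G k j) ->
  (forall j, G j j = 0) ->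
  \sum_j \sum_k G j k = 2 * \sum_(j < N) \sum_(k < N | (j < k)%N) G j k.
Proof.
move=> Gs G0; pose U (j k : 'I_N) := if (j < k)%N then G j k else 0.
under [in RHS]eq_bigr do rewrite big_mkcond.
rewrite -[X in 2 * X]/(\sum_j \sum_k U j k) mulr_natl mulr2n.
rewrite [X in _ + X]exchange_big -big_split; apply: eq_bigr => j _ /=.
rewrite -big_split; apply: eq_bigr => k _ /=; rewrite /U.
by case: ltngtP => [||/ord_inj->]; rewrite ?addr0 ?add0r.
Qed.

(** A sum over all ordered triples is invariant under cyclic permutation of
    (i, j, k); this is what turns the angles gathered around vertices into
    angles gathered in faces.  Each unordered face occurs 6 times, hence the
    factor. *)
Lemma weighted_curvature r v :
  6 * \sum_i v i * curvature T I r i = 12 * pi * (\sum_i v i) -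
  \sum_i \sum_j \sum_(k | [set i; j; k] \in faces T)
    (v i * inner_angle I r i j k + v j * inner_angle I r j k i
     + v k * inner_angle I r k i j).
Proof.
pose G i j k := if [set i; j; k] \in faces T then v i * inner_angle I r i j k else 0.
have GE : \sum_i \sum_j \sum_(k | [set i; j; k] \in faces T)
    (v i * inner_angle I r i j k + v j * inner_angle I r j k i
     + v k * inner_angle I r k i j)
  = 3 * \sum_i \sum_j \sum_k G i j k.
  transitivity (\sum_i \sum_j \sum_k G i j k + \sum_i \sum_j \sum_k G j k i
                + \sum_i \sum_j \sum_k G k i j).
    rewrite -!big_split; apply: eq_bigr => i _ /=.
    rewrite -!big_split; apply: eq_bigr => j _ /=.
    rewrite -!big_split big_mkcond; apply: eq_bigr => k _ /=.
    rewrite /G -(set3_cycle i j k) (set3_cycle k i j).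
    by case: ifP; rewrite ?addr0.
  by rewrite (sum_cycle G) -(sum_cycle (fun i j k => G k i j)); ring.
rewrite GE.
have KE i : v i * curvature T I r i =
    2 * pi * v i - 2^-1 * \sum_j \sum_k G i j k.
  rewrite (@sum_upper (G i)); first last.
  - by move=> j; rewrite /G; case: ifP => // /card_face/cards3_neq[_]; rewrite eqxx.
  - by move=> j k; rewrite /G set3_swap inner_angleC.
  rewrite /curvature mulrBr; congr (_ - _); first by ring.
  rewrite mulKf ?pnatr_eq0// mulr_sumr; apply: eq_bigr => j _.
  by rewrite mulr_sumr big_mkcondr.
rewrite (eq_bigr _ (fun i _ => KE i)) sumrB -!mulr_sumr.
by field.
Qed.

Lemma gauss_bonnet r : is_metric T I r ->
  \sum_i curvature T I r i = 2 * pi * (euler_char T)%:~R.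
Proof.
move=> hr; have := weighted_curvature r (fun=> 1).
under eq_bigr do rewrite mul1r.
set flags := (X in _ - X).
have {flags}-> : flags =
    \sum_(i < N) \sum_(j < N) \sum_(k < N | [set i; j; k] \in faces T) pi.
  apply: eq_bigr => i _; apply: eq_bigr => j _; apply: eq_bigr => k F; rewrite !mul1r.
  exact: inner_angle_sum.
have -> : \sum_(i < N) \sum_(j < N) \sum_(k < N | [set i; j; k] \in faces T) (pi : R)
   = pi * (6 * #|faces T|)%:R.
  rewrite -count_flags natr_sum mulr_sumr; apply: eq_bigr => i _.
  rewrite natr_sum mulr_sumr; apply: eq_bigr => j _.
  by rewrite natr_sum mulr_sumr; apply: eq_bigr => k _; rewrite mulr1.
rewrite sumr_const card_ord.
have := edges_faces T => /(congr1 (fun n => n%:R : R)).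
rewrite /euler_char !natrM rmorphD rmorphB /= -!pmulrn => e E.
apply: (@mulfI _ 6); first by rewrite pnatr_eq0.
rewrite E; set e' := #|edges T|%:R in e *; have -> : e' = 3 / 2 * #|faces T|%:R by lra.
by field.
Qed.

Lemma flag_monotone r r' v i j k : is_metric T I r -> is_metric T I r' ->
  (forall i, r' 0 i = r 0 i * expR (v i)) -> [set i; j; k] \in faces T ->
  ~~ [&& v i == v j & v j == v k] ->
  v i * inner_angle I r' i j k + v j * inner_angle I r' j k i
    + v k * inner_angle I r' k i j <
  v i * inner_angle I r i j k + v j * inner_angle I r j k i
    + v k * inner_angle I r k i j.
Proof.
move=> hr hr' r'E F nv.
have F2 := face_cycle F; have F3 := face_cycle F2.
rewrite !inner_angleE//.
have I1 := hI (face_edge F); have I2 := hI (face_edge F2).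
have I3 := hI (face_edge F3).
have := angle_pairing_decreasing (hr.1 i) (hr.1 j) (hr.1 k) I2 I3 I1 _ nv.
by rewrite /angle_pairing /edge_sqlen !r'E; apply; exact: heron_metric.
Qed.

Lemma edge_in_face i j : [set i; j] \in edges T ->
  exists k, [set i; j; k] \in faces T.
Proof.
move=> e; have : (0 < #|[set f in faces T | [set i; j] \subset f]|)%N by rewrite two_faces.
move=> /card_gt0P[f]; rewrite !inE subUset !sub1set => /andP[F /andP[fi fj]].
have ij : i != j by have := card_edge e; rewrite cards2; case: (i =P j).
have fj' : j \in f :\ i by rewrite !inE eq_sym ij.
have : (0 < #|f :\ i :\ j|)%N.
  by have := card_face F; rewrite (cardsD1 i) fi (cardsD1 j) fj' !add1n => -[->].
move=> /card_gt0P[k fk]; exists k.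
by have /eqP -> : [set i; j; k] == f by rewrite set3_eqE ?(card_face F)// fi fj' fk.
Qed.

Lemma constant_on_skeleton v : (forall i j, [set i; j] \in edges T -> v i = v j) ->
  forall i j, v i = v j.
Proof.
move=> ve i j; have /connectP[p + ->] := skeleton_connected T i j.
by elim: p i => //= a p IH i /andP[/ve -> /IH].
Qed.

(** By [flag_monotone] every face contributes a nonnegative amount to the sum,
    so the hypothesis forces each contribution to vanish, and the strictness
    in [flag_monotone] makes v constant on each face. *)
Lemma curvature_rigidity r r' v : is_metric T I r -> is_metric T I r' ->
  (forall i, r' 0 i = r 0 i * expR (v i)) ->
  \sum_i v i * (curvature T I r' i - curvature T I r i) <= 0 ->
  forall i j, v i = v j.
Proof.
move=> hr hr' r'E le0.
pose A r i j k := v i * inner_angle I r i j k + v j * inner_angle I r j k i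
  + v k * inner_angle I r k i j.
pose D i j k := if [set i; j; k] \in faces T then A r i j k - A r' i j k else 0.
have D0 i j k : 0 <= D i j k.
  rewrite /D; case: ifP => // F; rewrite subr_ge0.
  (* On a constant v both pairings are v times the angle sum pi. *)
  have [/andP[/eqP vij /eqP vjk]|nv] := boolP [&& v i == v j & v j == v k].
    by rewrite /A vij vjk -!mulrDr !inner_angle_sum.
  exact/ltW/flag_monotone.
have DE : \sum_i \sum_j \sum_k D i j k =
    6 * \sum_i v i * (curvature T I r' i - curvature T I r i).
  under [in RHS]eq_bigr do rewrite mulrBr.
  rewrite sumrB mulrBr !weighted_curvature.
  have sub2 (a b c : R) : a - b - (a - c) = c - b by ring.
  rewrite sub2 -sumrB; apply: eq_bigr => i _.
  rewrite -sumrB; apply: eq_bigr => j _.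
  by rewrite -sumrB [RHS]big_mkcond.
have S0 : \sum_i \sum_j \sum_k D i j k = 0.
  apply/eqP; rewrite eq_le; apply/andP; split; first by rewrite DE pmulr_rle0.
  by do 3 (apply: sumr_ge0 => ? _).
have DZ i j k : D i j k = 0.
  have Di : \sum_j \sum_k D i j k = 0.
    by apply: (psumr_eq0P _ S0) => // a _; do 2 (apply: sumr_ge0 => ? _).
  have Dj : \sum_k D i j k = 0.
    by apply: (psumr_eq0P _ Di) => // a _; apply: sumr_ge0 => ? _.
  exact: (psumr_eq0P _ Dj).
apply: constant_on_skeleton => i j /edge_in_face[k F].
have := DZ i j k; rewrite /D F => /eqP; rewrite subr_eq0 => /eqP E.
have [/andP[/eqP]//|nv] := boolP [&& v i == v j & v j == v k].
by have := flag_monotone hr hr' r'E F nv; rewrite -/(A r i j k) E ltxx.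
Qed.

End Global.

(** Normalizing w and w' changes the logarithmic differences by a constant,
    which pairs to 0 with the difference of two probability vectors; after that
    each term is nonnegative because ln is increasing. *)
Lemma log_weights_monotone (R : realType) (N : nat) (w w' : 'I_N -> R) :
  (0 < N)%N -> (forall i, 0 < w i) -> (forall i, 0 < w' i) ->
  0 <= \sum_i (ln (w' i) - ln (w i)) *
         (w' i / (\sum_j w' j) - w i / (\sum_j w j)).
Proof.
move=> N0 w0 w'0.
have sum_gt0 (u : 'I_N -> R) : (forall i, 0 < u i) -> 0 < \sum_j u j.
  move=> u0; rewrite (bigD1 (Ordinal N0))//= ltr_wpDr// sumr_ge0// => i _; exact: ltW.
have W0 := sum_gt0 _ w0; have W'0 := sum_gt0 _ w'0.
set W := \sum_j w j in W0 *; set W' := \sum_j w' j in W'0 *.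
have pE : \sum_i (w' i / W' - w i / W) = 0.
  by rewrite sumrB -!mulr_suml !divff ?subrr// gt_eqF.
have -> : \sum_i (ln (w' i) - ln (w i)) * (w' i / W' - w i / W) =
    \sum_i (ln (w' i) - ln (w i) - (ln W' - ln W)) * (w' i / W' - w i / W).
  by under [RHS]eq_bigr do rewrite mulrBl; rewrite sumrB -mulr_sumr pE mulr0 subr0.
apply: sumr_ge0 => i _.
have -> : ln (w' i) - ln (w i) - (ln W' - ln W) = ln (w' i / W') - ln (w i / W).
  by rewrite !ln_div ?posrE//; ring.
have p0 : 0 < w i / W by rewrite divr_gt0.
have p'0 : 0 < w' i / W' by rewrite divr_gt0.
have [le|/ltW le] := leP (w i / W) (w' i / W').
  by rewrite mulr_ge0// subr_ge0// ler_ln.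
by rewrite mulr_le0// subr_le0// ler_ln.
Qed.

Theorem theorem5p1 (R : realType) (N : nat) (T : surface_triangulation N)
    (I : {set 'I_N} -> R) (hI : inversive_distance T I)
    (alpha : R) (halpha : alpha * (euler_char T)%:~R <= 0)
    (r r' : 'rV[R]_N)
    (hr : constant_alpha_curvature T I alpha r)
    (hr' : constant_alpha_curvature T I alpha r') :
  exists2 lambda : R, 0 < lambda & r' = lambda *: r.
Proof.
have N0 := vertices_nonempty T; pose o := Ordinal N0.
have [mr cr] := hr; have [mr' cr'] := hr'.
pose v i := ln (r' 0 i) - ln (r 0 i).
have r'E i : r' 0 i = r 0 i * expR (v i).
  rewrite /v expRB !lnK ?posrE; [|exact: mr.1|exact: mr'.1].
  by rewrite mulrC divfK// gt_eqF// mr.1.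
suff vc : forall i j, v i = v j.
  exists (expR (v o)); first exact: expR_gt0.
  by apply/rowP => i; rewrite mxE r'E mulrC (vc i o).
apply: (curvature_rigidity hI mr mr' r'E).
pose w (r : 'rV[R]_N) i := powR (r 0 i) alpha.
have w0 r1 i : is_metric T I r1 -> 0 < w r1 i.
  by move=> m; rewrite powR_gt0// m.1.
have KE r1 : constant_alpha_curvature T I alpha r1 -> forall i,
   curvature T I r1 i = 2 * pi * (euler_char T)%:~R * (w r1 i / \sum_j w r1 j).
  move=> [m c] i.
  have K j : curvature T I r1 j = alpha_curvature T I alpha r1 o * w r1 j.
    by rewrite (c o j) /alpha_curvature divfK// gt_eqF// w0.
  have W0 : 0 < \sum_j w r1 j.
    by rewrite (bigD1 o)//= ltr_wpDr ?w0// sumr_ge0// => j _; rewrite ltW// w0.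
  rewrite -(gauss_bonnet hI m) (eq_bigr _ (fun j _ => K j)) -mulr_sumr K.
  by field; rewrite gt_eqF.
have Y0 := log_weights_monotone N0 (fun i => w0 r i mr) (fun i => w0 r' i mr').
set x := (euler_char T)%:~R in halpha KE.
under eq_bigr => i _ do rewrite (KE r' hr') (KE r hr) -mulrBr mulrCA.
rewrite -mulr_sumr; set Y := \sum_(i < N) _.
have aY : 0 <= alpha * Y.
  rewrite /Y mulr_sumr; move: Y0; congr (_ <= _); apply: eq_bigr => i _.
  by rewrite mulrA /w !ln_powR -mulrBr.
have [a0|a0] := eqVneq alpha 0.
  suff -> : Y = 0 by rewrite mulr0.
  have w1 r1 i : w r1 i = 1 by rewrite /w a0 powRr0.
  rewrite /Y big1// => i _; rewrite !w1.
  by rewrite !(eq_bigr _ (fun j _ => w1 _ j)) subrr mulr0.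
rewrite -mulrA pmulr_rle0 ?mulr_gt0 ?pi_gt0//.
(* alpha^2 chi Y = (alpha chi) (alpha Y). *)
rewrite -(pmulr_rle0 (x := alpha ^+ 2)); last first.
  by rewrite lt0r sqr_ge0 andbT expf_neq0.
by rewrite expr2 mulrACA mulr_le0_ge0.
Qed.
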